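(* Let $k\ge1$, $N\ge1$ be integers. For every admissible triple $(l,l'',l')$ of level $k$ the map $$c_{\mathcal C}(l,l'',l'):\ \mathcal C_{k,l'}^{(N)}\to\mathcal C_{k,l}^{(N+1)},\qquad(\mathbf a;\mathbf b)\mapsto(\mathbf a,a;\mathbf b,b),$$ $$a=y(l,l'',l'),\qquad b=z(l,l'',l')-\bigl(a_0-x(l,l'',l')\bigr)^+,$$ where $a_0$ is the last entry of $\mathbf a$, is well-defined. Moreover, for every $l\in\{0,\dots,k\}$, $$\mathcal C_{k,l}^{(N+1)}=\bigsqcup_{l'',l':\ (l,l'',l')\text{ admissible}}c_{\mathcal C}(l,l'',l')\,\mathcal C_{k,l'}^{(N)}$$ (disjoint union of images).
   Context: $t^+=\max(t,0)$, and $x(\alpha,\beta,\gamma)=\frac{\alpha+\gamma-\beta}2$, $y(\alpha,\beta,\gamma)=\frac{\alpha+\beta-\gamma}2$, $z(\alpha,\beta,\gamma)=\frac{\beta+\gamma-\alpha}2$. A triple $(\alpha,\beta,\gamma)\in\{0,\dots,k\}^3$ is an admissible (Verlinde) triple of level $k$ if $x,y,z$ evaluated on it are non-negative integers with $x+y+z\le k$. $\mathcal C_{k,l}^{(N)}$ (combinatorial paths of length $N$, level $k$, weight $l\in\{0,\dots,k\}$) is the set of all $(\mathbf a;\mathbf b)=(a_{N-1},\dots,a_0;b_{N-1},\dots,b_1)\in\{0,\dots,k\}^{2N-1}$ such that (1) $a_0\le l$; (2) $a_i+b_{i+1}+a_{i+1}\le k$ and $b_i+a_i+b_{i+1}\le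 k$ for all integers $i\ge0$; (3) $\sum_{s=i}^jb_s\le k+\sum_{s=i+1}^{j-2}a_s$ for all $-1\le i<j\le\infty$. Here $b_\infty=k$, $b_{-1}=l$, $b_0=a_{-1}=a_\infty=0$, and $a_i=b_i=0$ for $N\le i<\infty$; for $j=\infty$ the left sum includes the term $b_\infty=k$ and the right sum is over all $s\ge i+1$; empty sums are $0$. The notation $(\mathbf a,a;\mathbf b,b)$ means $(a_{N-1},\dots,a_0,a;\,b_{N-1},\dots,b_1,b)$, so that $a$ becomes the new ''$a_0$'', $b$ the new ''$b_1$'', and the indices of the old entries are shifted up by one. *)

(* Defs.v *)
From mathcomp Require Import all_boot all_order all_algebra.
From mathcomp Require Import boolp classical_sets functions.

Set Implicit Arguments.
Unset Strict Implicit.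
Unset Printing Implicit Defensive.

Import Order.TTheory GRing.Theory Num.Theory.
Local Open Scope classical_set_scope.
Local Open Scope ring_scope.

Definition twice_x (al be ga : nat) : int := al%:Z + ga%:Z - be%:Z.
Definition twice_y (al be ga : nat) : int := al%:Z + be%:Z - ga%:Z.
Definition twice_z (al be ga : nat) : int := be%:Z + ga%:Z - al%:Z.

(* The quotients by 2 are Euclidean; they are exact on admissible triples,
   the only ones on which x, y, z are used. *)
Definition tri_x (al be ga : nat) : int := (twice_x al be ga %/ 2)%Z.
Definition tri_y (al be ga : nat) : int := (twice_y al be ga %/ 2)%Z.
Definition tri_z (al be ga : nat) : int := (twice_z al be ga %/ 2)%Z.

Record admissible (k al be ga : nat) : Prop := Admissible {
  adm_bound : [/\ (al <= k)%N, (be <= k)%N & (ga <= k)%N];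
  adm_int : [/\ (2 %| twice_x al be ga)%Z, (2 %| twice_y al be ga)%Z
              & (2 %| twice_z al be ga)%Z];
  adm_ge0 : [/\ 0 <= tri_x al be ga, 0 <= tri_y al be ga
              & 0 <= tri_z al be ga];
  adm_level : tri_x al be ga + tri_y al be ga + tri_z al be ga <= k%:Z
}.

(* Families are listed by increasing index: a = [:: a_0; ...; a_(N-1)] and
   b = [:: b_1; ...; b_(N-1)].  Reading past the end of a list yields 0, which
   is the convention a_i = b_i = 0 for N <= i < oo.  Hence
     a_i = a`_i,   b_(i+1) = b`_i,   b_i = (0 :: b)`_i  (with b_0 = 0)
   for i >= 0, and, with the shift that makes indices >= -1 natural numbers,
     a_(s-1) = (0 :: a)`_s,   b_(s-1) = (l :: 0 :: b)`_s   for s >= 0.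
   path_sum is the third condition at (i-1, j-1) with j finite.  path_sum_oo is
   the same condition at (i-1, oo): its left-hand side contains b_oo = k, and
   the sums over all large indices may stop at shifted index N, that is at
   a_(N-1) and b_(N-1), since all later entries are 0. *)
Record is_path (k l N : nat) (a b : seq int) : Prop := IsPath {
  path_size : size a = N /\ size b = N.-1;
  path_bound_a : forall u : int, u \in a -> 0 <= u <= k%:Z;
  path_bound_b : forall u : int, u \in b -> 0 <= u <= k%:Z;
  path_a0 : a`_0 <= l%:Z;
  path_aba : forall i : nat, a`_i + b`_i + a`_i.+1 <= k%:Z;
  path_bab : forall i : nat, (0 :: b)`_i + a`_i + b`_i <= k%:Z;
  path_sum : forall i j : nat, (i < j)%N ->
    \sum_(i <= s < j.+1) (l%:Z :: 0 :: b)`_s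
      <= k%:Z + \sum_(i.+1 <= s < j.-1) (0 :: a)`_s;
  path_sum_oo : forall i : nat,
    \sum_(i <= s < N.+1) (l%:Z :: 0 :: b)`_s + k%:Z
      <= k%:Z + \sum_(i.+1 <= s < N.+1) (0 :: a)`_s
}.

Definition paths (k l N : nat) : set (seq int * seq int) :=
  [set p | is_path k l N p.1 p.2].

Definition pos_part (t : int) : int := Num.max t 0.

(* The new entries become the new a_0 and b_1, shifting the old indices up by
   one: with lists by increasing index they are put in front. *)
Definition c_map (l l'' l' : nat) (p : seq int * seq int) :
    seq int * seq int :=
  (tri_y l l'' l' :: p.1,
   tri_z l l'' l' - pos_part (p.1`_0 - tri_x l l'' l') :: p.2).

(* Main.v *)
Require Import Defs.
From mathcomp Require Import all_boot all_order all_algebra.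
From mathcomp Require Import boolp classical_sets functions.
From mathcomp Require Import zify.

Set Implicit Arguments.
Unset Strict Implicit.
Unset Printing Implicit Defensive.

(** Write a triple as l = x + y, l'' = y + z, l' = x + z.  It is admissible of
    level k exactly when x, y, z are natural numbers with x + y + z <= k
    (admissibleP), so for fixed l it is determined by y and z.

    Let a path of length N + 1 and weight l begin with a_0, a_1 and b_1.  If it
    is the image of a path of weight l', then y = a_0, x = l - a_0 and
    b_1 = z - (a_1 - x)^+, and the last equation is equivalent to
      l' = b_1 + max(a_1, l - a_0).
    Hence y, z, x and l', l'' can be read off the image; this gives
    disjointness (c_map_inj).

    Everything else is the statement that, for this value of l', the longer
    family is a path of weight l if and only if its tail is a path of weight l'
    and 0 <= a_0 <= l, 0 <= b_1, a_0 + l' <= k (is_path_cons), the last bound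
    being x + y + z <= k.  The reason is that an upper bound on l' is a pair of
    upper bounds, one on b_1 + a_1 and one on b_1 + l - a_0.  In condition (3)
    of the tail at i = 0 (indices of the longer family), where the weight l'
    replaces b_0 + b_1, the first is condition (3) of the longer path at i = 1,
    after cancelling the a_1 that starts the right-hand sum, and the second is
    condition (3) at i = -1, after cancelling a_0.  Condition (3) of the longer
    path at i = 0 follows from the one at i = 1, because a_1 >= 0; for i >= 2
    the conditions coincide; for small j the cancellation is unavailable, and
    condition (2) and the bound a_0 + l' <= k take over. *)

Local Open Scope classical_set_scope.

Import Order.TTheory GRing.Theory Num.Theory.
Local Open Scope ring_scope.

Lemma sum_nth_consS (c : int) (u : seq int) (i j : nat) :
  \sum_(i.+1 <= s < j.+1) (c :: u)`_s = \sum_(i <= s < j) u`_s.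
Proof. by rewrite big_add1. Qed.

Lemma sum_nth_cons0 (c : int) (u : seq int) (j : nat) :
  \sum_(0 <= s < j.+1) (c :: u)`_s = c + \sum_(0 <= s < j) u`_s.
Proof. by rewrite big_nat_recl. Qed.

Lemma sum_nth_to0 (u : seq int) (i : nat) : \sum_(i <= s < 0) u`_s = 0.
Proof. by rewrite big_geq. Qed.

Lemma sum_nth_from1_to1 (u : seq int) (i : nat) :
  \sum_(i.+1 <= s < 1) u`_s = 0.
Proof. by rewrite big_geq. Qed.

(** A normal form for the sums over shifted index intervals: explicit leading
    entries followed by one sum over the common tail, so that two inequalities
    about a path and its tail become comparable by linear arithmetic. *)
Definition sum_nthE :=
  (sum_nth_consS, sum_nth_cons0, sum_nth_to0, sum_nth_from1_to1).

(** The inductive structure of paths: removing the first entries turns the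
    weight l into l'.  The value of l' is the one forced by the gluing formula
    b_1 = z - (a_1 - x)^+ with x = l - a_0 and z = l' - x, and a_0 + l' is the
    level x + y + z of the triple. *)
Lemma is_path_cons (k l l' N : nat) (a0 a1 b1 : int) (a b : seq int)
    (def_l' : l'%:Z = b1 + Num.max a1 (l%:Z - a0)) :
  is_path k l N.+2 (a0 :: a1 :: a) (b1 :: b) <->
  [/\ 0 <= a0 <= l%:Z, 0 <= b1, a0 + l'%:Z <= k%:Z
    & is_path k l' N.+1 (a1 :: a) b].
Proof.
split.
- case=> -[/= sza szb] Ha Hb /= Ha0 Haba Hbab Hsum Hoo.
  have a0P : 0 <= a0 <= k%:Z by apply: Ha; rewrite inE eqxx.
  have a1P : 0 <= a1 <= k%:Z by apply: Ha; rewrite !inE eqxx orbT.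
  have b1P : 0 <= b1 <= k%:Z by apply: Hb; rewrite inE eqxx.
  have := Hbab 1%N.
  (* These two give a_0 + l' = max (a_0 + b_1 + a_1) (l + b_1) <= k. *)
  have := Haba 0%N; have := Hsum 0%N 2%N isT.
  rewrite !sum_nthE /= => h1 h3 h2.
  have lev : a0 + l'%:Z <= k%:Z by lia.
  split; [lia|lia|exact: lev|split].
  + by split=> /=; lia.
  + by move=> u uP; apply: Ha; rewrite inE uP orbT.
  + by move=> u uP; apply: Hb; rewrite inE uP orbT.
  + by rewrite /=; lia.
  + by move=> i; exact: (Haba i.+1).
  + case=> [|i]; last exact: (Hbab i.+2).
    by move: (Hbab 1%N) => /=; lia.
  + (* At shifted index i = 0 the tail carries l': the terms a_1 and l - a_0
       of the maximum are bounded by the conditions at shifted indices i = 2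
       and i = 0 of the longer path; for j = 2 the bound on b_1 + a_1 + b_2
       replaces the former, and for j = 1 the level bound suffices. *)
    case=> [|[|i]] [|[|[|j]]] // ij.
    * by rewrite !sum_nthE; lia.
    * rewrite !sum_nthE.
      move: (Hsum 0%N 3%N isT).
      rewrite !sum_nthE !big_nat1 /=.
      by lia.
    * move: (Hsum 0%N j.+4 isT) (Hsum 2%N j.+4 isT).
      rewrite !sum_nthE.
      by lia.
    * move: (Hsum 2%N 3%N isT).
      rewrite !sum_nthE.
      by lia.
    * move: (Hsum 2%N j.+4 isT).
      rewrite !sum_nthE.
      by lia.
    * move: (Hsum i.+3 j.+4 ij).
      by rewrite !sum_nthE.
  + case=> [|[|i]].
    * move: (Hoo 0%N) (Hoo 2%N).
      rewrite !sum_nthE.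
      by lia.
    * move: (Hoo 2%N).
      rewrite !sum_nthE.
      by lia.
    * move: (Hoo i.+3).
      by rewrite !sum_nthE.
- case=> a0P b1P lev [[/= sza szb] Ha Hb /= Ha0 Haba Hbab Hsum Hoo].
  have a1P : 0 <= a1 <= k%:Z by apply: Ha; rewrite inE eqxx.
  (* This is l' + b_2 <= k, which bounds b_1 + a_1 + b_2 as b_1 + a_1 <= l'. *)
  have := Hsum 0%N 2%N isT.
  rewrite !sum_nthE big_nat1 /= => h1.
  split.
  + by split=> /=; lia.
  + by move=> u; rewrite inE => /orP[/eqP->|]; [lia|exact: Ha].
  + by move=> u; rewrite inE => /orP[/eqP->|]; [lia|exact: Hb].
  + by rewrite /=; lia.
  + by case=> [|i]; [rewrite /=; lia|exact: (Haba i)].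
  + case=> [|[|i]] /=; [lia| |exact: (Hbab i.+1)].
    by lia.
  + (* The conditions at shifted indices i = 0, 1, 2 all come from the one of
       the tail at i = 0, or from the level bound when j is small, because l'
       dominates b_1 + l - a_0, b_1 and b_1 + a_1 respectively. *)
    case=> [|[|[|i]]] [|[|[|[|j]]]] // ij;
      rewrite !sum_nthE.
    * by lia.
    * by lia.
    * by rewrite big_nat1 /=; lia.
    * move: (Hsum 0%N j.+3 isT).
      by rewrite !sum_nthE; lia.
    * by lia.
    * by rewrite big_nat1 /=; lia.
    * move: (Hsum 0%N j.+3 isT).
      by rewrite !sum_nthE; lia.
    * by rewrite big_nat1 /=; lia.
    * move: (Hsum 0%N j.+3 isT).
      by rewrite !sum_nthE; lia.
    * move: (Hsum i.+2 j.+3 ij).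
      by rewrite !sum_nthE; lia.
  + case=> [|[|[|i]]].
    1-3: move: (Hoo 0%N);
      by rewrite !sum_nthE; lia.
    move: (Hoo i.+2).
    by rewrite !sum_nthE.
Qed.

Lemma tri_xyzE (x y z : nat) :
  [/\ tri_x (x + y) (y + z) (x + z) = x%:Z,
      tri_y (x + y) (y + z) (x + z) = y%:Z
    & tri_z (x + y) (y + z) (x + z) = z%:Z].
Proof.
by split; rewrite /tri_x /tri_y /tri_z /twice_x /twice_y /twice_z; lia.
Qed.

(** Parametrizing by natural numbers x, y, z removes the parity conditions and
    the Euclidean quotients by 2. *)
Lemma admissibleP (k l l'' l' : nat) :
  admissible k l l'' l' <->
  exists x y z : nat,
    [/\ l = (x + y)%N, l'' = (y + z)%N, l' = (x + z)%N & (x + y + z <= k)%N].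
Proof.
split=> [[[lk l''k l'k]]|[x [y [z [-> -> -> xyzk]]]]].
  rewrite /tri_x /tri_y /tri_z /twice_x /twice_y /twice_z.
  case=> dx dy dz [x0 y0 z0] lev.
  exists `|tri_x l l'' l'|%N, `|tri_y l l'' l'|%N, `|tri_z l l'' l'|%N.
  rewrite /tri_x /tri_y /tri_z /twice_x /twice_y /twice_z.
  by split; lia.
have [xE yE zE] := tri_xyzE x y z.
split; rewrite ?xE ?yE ?zE; first by split; lia.
- by rewrite /twice_x /twice_y /twice_z; split; lia.
- by [].
- by lia.
Qed.

Lemma c_map_path (k l l'' l' N : nat) (p : seq int * seq int) :
  admissible k l l'' l' -> paths k l' N.+1 p ->
  paths k l N.+2 (c_map l l'' l' p).
Proof.
move=> /admissibleP[x [y [z [-> -> -> xyzk]]]].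
case: p => -[|a1 a] b; rewrite /paths /= => pP; first by case: (path_size pP).
have [xE yE zE] := tri_xyzE x y z.
have /= a1l := path_a0 pP.
rewrite /c_map xE yE zE /pos_part /=.
by apply/(@is_path_cons _ _ (x + z)%N); [|split=> //]; lia.
Qed.

(** The triple is read off the path: y = a_0, x = l - a_0, and z is solved from
    b_1 = z - (a_1 - x)^+. *)
Lemma c_map_surj (k l N : nat) (p : seq int * seq int) :
  paths k l N.+2 p ->
  exists l'' l' q,
    [/\ admissible k l l'' l', paths k l' N.+1 q & c_map l l'' l' q = p].
Proof.
case: p => -[|a0 [|a1 a]] [|b1 b]; rewrite /paths /= => pP;
  try by case: (path_size pP).
have /= a0l := path_a0 pP.
have a0_ge0 : 0 <= a0.
  by have /andP[] := path_bound_a pP (mem_head _ _).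
have b1_ge0 : 0 <= b1.
  by have /andP[] := path_bound_b pP (mem_head _ _).
pose x := `|l%:Z - a0|%N; pose y := `|a0|%N.
pose z := `|(b1 + pos_part (a1 - x%:Z))%R|%N.
have def_l' : (x + z)%N%:Z = b1 + Num.max a1 (l%:Z - a0).
  by rewrite /x /z /pos_part; lia.
have [_ _ lev qP] := (@is_path_cons k l (x + z) N a0 a1 b1 a b def_l').1 pP.
have lE : l = (x + y)%N by rewrite /x /y; lia.
exists (y + z)%N, (x + z)%N, (a1 :: a, b); split=> //.
  apply/admissibleP; exists x, y, z; split=> //; lia.
have [xE yE zE] := tri_xyzE x y z.
rewrite lE /c_map xE yE zE /=.
by congr (_ :: _, _ :: _); rewrite /z /y /pos_part; lia.
Qed.

(** The new a_0 is y, which determines x = l - y, and then the new b_1 and the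
    old a_0 determine z. *)
Lemma c_map_inj (k l l1'' l1' l2'' l2' : nat) (p1 p2 : seq int * seq int) :
  admissible k l l1'' l1' -> admissible k l l2'' l2' ->
  c_map l l1'' l1' p1 = c_map l l2'' l2' p2 -> (l1'', l1') = (l2'', l2').
Proof.
move=> /admissibleP[x1 [y1 [z1 [lE1 -> -> _]]]].
move=> /admissibleP[x2 [y2 [z2 [lE2 -> -> _]]]].
have [xE1 yE1 zE1] := tri_xyzE x1 y1 z1.
have [xE2 yE2 zE2] := tri_xyzE x2 y2 z2.
rewrite /c_map {1 2 3}lE1 lE2 xE1 yE1 zE1 xE2 yE2 zE2 => -[y12 -> z12 _].
have x12 : x1 = x2 by lia.
have {}z12 : z1 = z2 by move: z12; rewrite x12; lia.
by congr (_, _); lia.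
Qed.

Local Close Scope ring_scope.

Theorem proposition3p3p1 (k N : nat) (hk : (1 <= k)%N) (hN : (1 <= N)%N) :
  (forall l l'' l' : nat, admissible k l l'' l' ->
     set_fun (paths k l' N) (paths k l N.+1) (c_map l l'' l')) /\
  (forall l : nat, (l <= k)%N ->
     paths k l N.+1 =
       \bigcup_(t in [set t : nat * nat | admissible k l t.1 t.2])
          (c_map l t.1 t.2 @` paths k t.2 N) /\
     trivIset [set t : nat * nat | admissible k l t.1 t.2]
       (fun t => c_map l t.1 t.2 @` paths k t.2 N)).
Proof.
case: N hN => // N _; split=> [l l'' l' adm p|l _].
  exact: c_map_path.
split.
  apply/seteqP; split=> [p /c_map_surj[l'' [l' [q [adm qP <-]]]]|p].
    by exists (l'', l') => //; exists q.
  by case=> -[l'' l'] /= adm [q qP <-]; exact: c_map_path adm qP.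
move=> [l1'' l1'] [l2'' l2'] /= adm1 adm2 [p [[q1 _ <-] [q2 _ q12]]].
exact/esym/(c_map_inj adm2 adm1 q12).
Qed.
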